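(* Let $X$ be a Kelley continuum. Then $\pi(x)=B(x)$ for every $x\in X$ such that the closure of $B(x)$ in $X$ is not equal to $X$.
   Context: A continuum is a nonempty compact connected metric space. $2^X$ is the space of all nonempty closed subsets of $X$ with the Hausdorff metric $\mathcal H$, and $\mathcal C(X)\subset 2^X$ is the subspace of connected ones. A continuum $X$ with metric $d$ is a Kelley continuum (has Kelley's property) if for each $\epsilon>0$ there is $\delta>0$ such that whenever $p,q\in X$ with $d(p,q)<\delta$ and $A\in\mathcal C(X)$ with $p\in A$, there exists $B\in\mathcal C(X)$ with $q\in B$ and $\mathcal H(A,B)<\epsilon$. An order arc is a continuous map $\alpha:[0,1]\to 2^X$ such that $\alpha(s)\subsetneq\alpha(t)$ whenever $0\le s<t\le 1$. For $A, B \in 2^X$, $B$ does not block $A$ if there is a continuous map $\gamma:[0,1]\to 2^X$ with $\gamma(0)=A$, $\gamma(1)=X$ and $\gamma(t)\cap B=\emptyset$ for all $t<1$; otherwise $B$ blocks $A$. For $a \in X$, $B(a)=\{y\in X : \{a\}\text{ blocks }\{y\}\}$. A nonblocker of $X$ is a set $A\in 2^X\setminus\{X\}$ such that for every $x\in X\setminus A$ there is an order arc $\alpha:[0,1]\to \mathcal C(X)$ with $\alpha(0)=\{x\}$, $\alpha(1)=X$ and $\alpha(t)\cap A=\emptyset$ for all $t\in[0,1)$. For $a\in X$, $\pi(a)$ is the intersection of all nonblockers of $X$ containing $a$ if at least one exists, and $\pi(a)=X$ otherwise. *)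

(* Defs.v *)
From HB Require Import structures.
From mathcomp Require Import all_boot all_order all_algebra.
From mathcomp Require Import all_classical all_reals all_analysis.

Set Implicit Arguments.
Unset Strict Implicit.
Unset Printing Implicit Defensive.

Import Order.TTheory GRing.Theory Num.Theory.
Import numFieldTopology.Exports numFieldNormedType.Exports.

Local Open Scope classical_set_scope.
Local Open Scope ring_scope.

HB.mixin Record isContinuum (R : realType) X & Metric R X := {
  continuum_nonempty : [set: X] !=set0 ;
  continuum_compact : compact [set: X] ;
  continuum_connected : connected [set: X] }.

#[short(type="continuumType")]
HB.structure Definition Continuum (R : realType) :=
  { X of Metric R X & isContinuum R X }.

(* The hyperspace 2^X. *)
Record hyperspace (R : realType) (X : continuumType R) := Hyperspace {
  hset :> set X ;
  hset_closed : closed hset ;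
  hset_nonempty : hset !=set0 }.

HB.instance Definition _ (R : realType) (X : continuumType R) :=
  gen_eqMixin (hyperspace X).
HB.instance Definition _ (R : realType) (X : continuumType R) :=
  gen_choiceMixin (hyperspace X).

Lemma hyperspace_eq (R : realType) (X : continuumType R) (A B : hyperspace X) :
  hset A = hset B -> A = B.
Proof.
case: A B => [A cA A0] [B cB B0] /= AB; case: _ / AB in cB B0 *.
by congr Hyperspace; exact: Prop_irrelevance.
Qed.

Section hausdorff_metric.
Context {R : realType} {X : continuumType R}.
Implicit Types A B C : set X.

Definition in_neighborhood (e : R) A B :=
  forall a, A a -> exists2 b, B b & mdist a b < e.

Definition hausdorff_radii A B : set R :=
  [set e | [/\ 0 < e, in_neighborhood e A B & in_neighborhood e B A]].

Definition hausdorff_dist A B : R := inf (hausdorff_radii A B).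

Lemma hausdorff_radiiC A B : hausdorff_radii A B = hausdorff_radii B A.
Proof. by apply/seteqP; split => e [? ? ?]; split. Qed.


Lemma hausdorff_radii_has_lbound A B : has_lbound (hausdorff_radii A B).
Proof. by exists 0 => e [/ltW]. Qed.

Lemma hausdorff_dist_le A B e : hausdorff_radii A B e -> hausdorff_dist A B <= e.
Proof. by move=> ABe; apply: ge_inf => //; exact: hausdorff_radii_has_lbound. Qed.

Lemma continuum_bounded : exists2 M : R, 0 < M & forall x y : X, mdist x y < M.
Proof.
have [x0 _] := @continuum_nonempty R X.
have /compact_near_coveringP cov := @continuum_compact R X.
have [|N [Nr NP]] :=
    cov R (pinfty_nbhs R) (fun M x => mdist x0 x < M) _.
  move=> x _; exists (ball x 1, [set M | mdist x0 x + 1 < M]) => /=.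
    split; first exact: nbhsx_ballx.
    by apply: nbhs_pinfty_gt; exact: num_real.
  move=> [y M] /= []; rewrite ballEmdist /= => xy.
  apply: le_lt_trans; apply: le_trans (metric_triangle x0 x y) _.
  by rewrite lerD2l ltW.
pose M := Num.max N 0 + 1.
have M0 : 0 < M by rewrite ltr_wpDl// le_max lexx orbT.
have x0M x : mdist x0 x < M.
  by apply: (NP M) => //; rewrite ltr_pwDr// le_max lexx.
exists (M + M); first by rewrite addr_gt0.
move=> x y; apply: le_lt_trans (metric_triangle x x0 y) _.
by rewrite metric_sym ltrD.
Qed.

Lemma hausdorff_radii_has_inf (A B : hyperspace X) :
  has_inf (hausdorff_radii A B).
Proof.
split; last exact: hausdorff_radii_has_lbound.
have [M M0 bM] := continuum_bounded.
have [a Aa] := hset_nonempty A; have [b Bb] := hset_nonempty B.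
by exists M; split => // x _; [exists b|exists a].
Qed.

Lemma hausdorff_dist_lt (A B : hyperspace X) e :
  hausdorff_dist A B < e -> hausdorff_radii A B e.
Proof.
move=> /inf_lt -/(_ (hausdorff_radii_has_inf A B).1) [r [r0 AB BA] re].
split; first exact: lt_trans re.
- by move=> a /AB [b Bb ab]; exists b => //; exact: lt_trans re.
- by move=> b /BA [a Aa ab]; exists a => //; exact: lt_trans re.
Qed.

Lemma hausdorff_dist_ge0 (A B : hyperspace X) : 0 <= hausdorff_dist A B.
Proof.
apply: lb_le_inf; first exact: (hausdorff_radii_has_inf A B).1.
by move=> e [/ltW].
Qed.

Lemma hausdorff_distxx (A : hyperspace X) : hausdorff_dist A A = 0.
Proof.
apply/eqP; rewrite eq_le hausdorff_dist_ge0 andbT; apply/ler_addgt0Pl => e e0.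
rewrite addr0; apply: hausdorff_dist_le.
by split => // a Aa; exists a => //; rewrite mdistxx.
Qed.

Lemma hausdorff_dist_positivity (A B : hyperspace X) :
  hausdorff_dist A B = 0 -> A = B.
Proof.
move=> AB0.
have near0 e : 0 < e -> hausdorff_radii A B e.
  by move=> e0; apply: hausdorff_dist_lt; rewrite AB0.
apply/hyperspace_eq/seteqP; split => x Cx.
- apply: (@hset_closed _ _ B) => U /nbhs_ballP [e /= e0 eU].
  have [_ /(_ _ Cx) [y By xy] _] := near0 _ e0.
  by exists y; split => //; apply: eU; rewrite ballEmdist.
- apply: (@hset_closed _ _ A) => U /nbhs_ballP [e /= e0 eU].
  have [_ _ /(_ _ Cx) [y Ay xy]] := near0 _ e0.
  by exists y; split => //; apply: eU; rewrite ballEmdist.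
Qed.

Lemma hausdorff_distC A B : hausdorff_dist A B = hausdorff_dist B A.
Proof. by rewrite /hausdorff_dist hausdorff_radiiC. Qed.

Lemma in_neighborhood_trans e f A B C : in_neighborhood e A B ->
  in_neighborhood f B C -> in_neighborhood (e + f) A C.
Proof.
move=> AB BC a /AB [b /BC [c Cc bc] ab]; exists c => //.
by apply: le_lt_trans (metric_triangle a b c) _; rewrite ltrD.
Qed.

Lemma hausdorff_dist_triangle (B A C : hyperspace X) :
  hausdorff_dist A C <= hausdorff_dist A B + hausdorff_dist B C.
Proof.
apply/ler_addgt0Pl => e e0; rewrite addrC (splitr e) addrACA.
have e20 : 0 < e / 2 by rewrite divr_gt0.
have [r1 AB BA] := @hausdorff_dist_lt A B (hausdorff_dist A B + e / 2)
  ltac:(by rewrite ltrDl).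
have [r2 BC CB] := @hausdorff_dist_lt B C (hausdorff_dist B C + e / 2)
  ltac:(by rewrite ltrDl).
apply: hausdorff_dist_le; split; first exact: addr_gt0.
- exact: in_neighborhood_trans AB BC.
- by rewrite addrC; exact: in_neighborhood_trans CB BA.
Qed.

End hausdorff_metric.

HB.instance Definition _ (R : realType) (X : continuumType R) :=
  @isMetric.Build R (hyperspace X) (fun A B => hausdorff_dist A B)
    hausdorff_distxx hausdorff_dist_positivity
    (fun A B => hausdorff_distC A B) hausdorff_dist_triangle.

Lemma hset1_closed (R : realType) (X : continuumType R) (x : X) :
  closed [set x].
Proof.
apply: accessible_closed_set1; apply: hausdorff_accessible.
exact: metric_hausdorff.
Qed.

Definition hset1 (R : realType) (X : continuumType R) (x : X) : hyperspace X :=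
  Hyperspace (@hset1_closed R X x) (ex_intro _ x erefl).

Section blocking.
Context {R : realType} {X : continuumType R}.
Implicit Types (A B : hyperspace X) (a x y p q : X).

Definition subcontinua : set (hyperspace X) := [set A | connected A].

(* Paths parametrized by [0, 1] are total functions on R of which only the
   restriction to `[0, 1] matters. *)
Definition is_path (g : R -> hyperspace X) := {within `[0, 1], continuous g}.

Definition order_arc (g : R -> hyperspace X) :=
  is_path g /\
  forall s t, 0 <= s -> s < t -> t <= 1 -> (g s : set X) `<` (g t : set X).

Definition does_not_block B A :=
  exists g : R -> hyperspace X,
    [/\ is_path g, g 0 = A, hset (g 1) = setT &
        forall t, 0 <= t < 1 -> hset (g t) `&` hset B = set0].

Definition blocks B A := ~ does_not_block B A.

(* The set B(a). *)
Definition blocked_by a : set X := [set y | blocks (hset1 a) (hset1 y)].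

Definition nonblocker A :=
  hset A <> setT /\
  forall x, ~ hset A x -> exists g : R -> hyperspace X,
    [/\ order_arc g, forall t, 0 <= t <= 1 -> subcontinua (g t),
        g 0 = hset1 x, hset (g 1) = setT &
        forall t, 0 <= t < 1 -> hset (g t) `&` hset A = set0].

(* The set pi(a); when no nonblocker contains a, the empty intersection is setT,
   as required. *)
Definition nonblocker_hull a : set X :=
  \bigcap_(A in [set A | nonblocker A /\ hset A a]) hset A.

End blocking.

Definition kelley (R : realType) (X : continuumType R) :=
  forall e : R, 0 < e -> exists2 d : R, 0 < d &
    forall (p q : X) (A : hyperspace X),
      mdist p q < d -> subcontinua A -> hset A p ->
      exists B : hyperspace X,
        [/\ subcontinua B, hset B q & mdist A B < e].

(* Main.v *)
(* Call y equivalent to z when some subcontinuum missing x contains both.  A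
   path in 2^X from {y} to X that avoids x until time 1 sweeps out a growing
   family of closed sets; conversely any subcontinuum K through y is reached
   from {y} by a chain of closed subsets of K without gaps, so if z in K is not
   blocked by x then neither is y: the complement of B(x) is a union of
   equivalence classes.  Hence an order arc from an unblocked point that misses
   x misses all of B(x), and B(x), once it is closed, is a nonblocker.  For
   closedness take an unblocked p and a subcontinuum K of an order arc from p
   that misses x and enters the open set X \ cl B(x); by Kelley's property every
   point near p lies on a continuum close to K, which again misses x and meets
   X \ cl B(x), so that point is unblocked.

   Gapless chains are parametrized by a Whitney-type size function.  A chain
   from {y} to K comes from iterating e-neighborhoods in K, starting at {y}, and
   passing to the limit e -> 0 along an ultrafilter. *)
From HB Require Import structures.
Require Import Defs.
From mathcomp Require Import all_boot all_order all_algebra.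
From mathcomp Require Import all_classical all_reals all_analysis.
From mathcomp Require Import lra.

Set Implicit Arguments.
Unset Strict Implicit.
Unset Printing Implicit Defensive.

Import Order.TTheory GRing.Theory Num.Theory.
Import numFieldTopology.Exports numFieldNormedType.Exports.

Local Open Scope classical_set_scope.
Local Open Scope ring_scope.

(** * Distances to a set, and dense sequences in a continuum *)

Section distance_to_a_set.
Context {R : realType} {X : continuumType R}.
Implicit Types (A B : set X) (x p : X) (e h : R).

Definition dist_set x A : R := inf [set mdist x a | a in A].

Lemma dist_set_ge0 x A : A !=set0 -> 0 <= dist_set x A.
Proof.
move=> [a Aa]; apply: lb_le_inf; first by exists (mdist x a), a.
by move=> _ [b _ <-]; exact: mdist_ge0.
Qed.

Lemma dist_set_le x A a : A a -> dist_set x A <= mdist x a.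
Proof.
move=> Aa; apply: ge_inf; last by exists a.
by exists 0 => _ [b _ <-]; exact: mdist_ge0.
Qed.

Lemma dist_set_ge x A e : A !=set0 ->
  (forall a, A a -> e <= mdist x a) -> e <= dist_set x A.
Proof.
move=> [a Aa] H; apply: lb_le_inf; first by exists (mdist x a), a.
by move=> _ [b Ab <-]; exact: H.
Qed.

Lemma dist_set_subset x A B : A !=set0 -> A `<=` B ->
  dist_set x B <= dist_set x A.
Proof. by move=> A0 AB; apply: dist_set_ge => // a /AB; exact: dist_set_le. Qed.

Lemma dist_set_in_neighborhood x A B e : A !=set0 -> in_neighborhood e A B ->
  dist_set x B <= dist_set x A + e.
Proof.
move=> A0 AB; rewrite -lerBlDr; apply: dist_set_ge => // a /AB[b Bb ab].
rewrite lerBlDr; apply: le_trans (dist_set_le x Bb) _.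
by apply: le_trans (metric_triangle x a b) _; rewrite lerD2l ltW.
Qed.

(** A compact metric space has a countable base; one point from each nonempty basic set gives a
    dense sequence, and compactness lets finitely many of its terms serve all [p] for a given
    [e]. *)
Lemma exists_uniformly_dense_sequence : exists u : nat -> X,
  forall e, 0 < e -> exists N, forall p, exists2 i, (i < N)%N & mdist (u i) p < e.
Proof.
have [x0 _] := @continuum_nonempty R X.
pose Y : pseudoPMetricType R := HB.pack X (isPointed.Build X x0).
have [B /countable_injP[f fI] [_ Bbase]] :=
  @compact_second_countable R Y (@continuum_compact R X).
(* The injection [f] numbers the basic sets; [x0] is the default when [n] is not the number of a
   nonempty one. *)
pose u n := xget x0 [set x | exists U, [/\ B U, f U = n & U x]].
exists u => e e0.
suff : \forall N \near \oo, [set: X] `<=`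
    (fun N p => exists2 i, (i < N)%N & mdist (u i) p < e) N.
  by case=> N _ /(_ N) NP; exists N => p; exact: NP (leqnn _) p I.
apply: (compact_near_coveringP _).1; first exact: continuum_compact.
move=> p _; have e20 : 0 < e / 2 by rewrite divr_gt0.
have [U [BU Up Ue]] := Bbase p _ (nbhsx_ballx p (e / 2) e20).
have [V [BV fV Vu]] : exists U', [/\ B U', f U' = f U & U' (u (f U))].
  by apply: (@xgetPex _ x0 [set x | exists U', [/\ B U', f U' = f U & U' x]]);
     exists p, U.
have VU : V = U by apply: fI => //; rewrite inE.
exists (ball p (e / 2), [set N | (f U < N)%N]) => /=.
  by split; [exact: nbhsx_ballx | exact: nbhs_infty_gt].
move=> [q N] /= [pq fN]; exists (f U) => //.
apply: le_lt_trans (metric_triangle _ p _) _; rewrite (splitr e).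
move: pq; rewrite ballEmdist /= => pq; apply: ltrD => //.
by rewrite VU in Vu; move: (Ue _ Vu); rewrite ballEmdist /= metric_sym.
Qed.

End distance_to_a_set.

(* A decreasing analogue of a Whitney map: the weighted sum of the distances
   to the points of a dense sequence. *)
Section thinness.
Context {R : realType} {X : continuumType R}.
Variable u : nat -> X.
Implicit Types (A B : set X) (x p : X) (e h : R).

Definition thinness A : R :=
  limn (series (fun n => dist_set (u n) A * 2^-1 ^+ n)).

Let half_series n : series (fun k => 2^-1 ^+ k : R) n <= 2.
Proof.
suff -> : series (fun k => 2^-1 ^+ k : R) n = 2 - 2 * 2^-1 ^+ n.
  by rewrite gerBl mulr_ge0 ?exprn_ge0 ?invr_ge0.
rewrite /series /=; elim: n => [|n IHn]; first by rewrite big_geq// expr0; lra.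
by rewrite big_nat_recr//= IHn exprS; lra.
Qed.

Let half_series_scale c n :
  series (fun k => c * 2^-1 ^+ k : R) n = c * series (fun k => 2^-1 ^+ k : R) n.
Proof. by rewrite /series /= mulr_sumr. Qed.

Lemma is_cvg_thinness A : A !=set0 ->
  cvgn (series (fun n => dist_set (u n) A * 2^-1 ^+ n)).
Proof.
move=> A0; have [a Aa] := A0; have [M M0 bM] := @continuum_bounded R X.
apply: (@series_le_cvg _ _ (geometric M 2^-1)) => [n|n|n|].
- by rewrite mulr_ge0 ?exprn_ge0 ?invr_ge0// dist_set_ge0.
- by rewrite /= mulr_ge0 ?exprn_ge0 ?invr_ge0// ltW.
- rewrite /= ler_wpM2r ?exprn_ge0 ?invr_ge0//.
  exact: le_trans (dist_set_le _ Aa) (ltW (bM _ _)).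
- by apply: is_cvg_geometric_series; rewrite ger0_norm ?invr_ge0// invf_lt1// ltr1n.
Qed.

Let thinnessB A B : A !=set0 -> B !=set0 ->
  series (fun n => (dist_set (u n) A - dist_set (u n) B) * 2^-1 ^+ n) @ \oo
    --> thinness A - thinness B.
Proof.
move=> A0 B0.
have -> : series (fun n => (dist_set (u n) A - dist_set (u n) B) * 2^-1 ^+ n) =
  series (fun n => dist_set (u n) A * 2^-1 ^+ n) -
  series (fun n => dist_set (u n) B * 2^-1 ^+ n).
  apply/funext => n; rewrite !fctE /series /= -sumrB; apply: eq_bigr => i _.
  by rewrite mulrBl.
by apply: cvgB; exact: is_cvg_thinness.
Qed.

(** Each distance changes by at most [e], and the weights sum to at most 2. *)
Lemma thinness_in_neighborhood A B e : 0 <= e -> A !=set0 -> B !=set0 ->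
  in_neighborhood e B A -> thinness A - thinness B <= 2 * e.
Proof.
move=> e0 A0 B0 BA; rewrite -(cvg_lim _ (thinnessB A0 B0))//.
apply: limr_le; first by apply: cvgP; exact: thinnessB.
near=> n; apply: (@le_trans _ _ (series (fun k => e * 2^-1 ^+ k : R) n)).
  apply: ler_sum => i _; rewrite ler_wpM2r ?exprn_ge0 ?invr_ge0//.
  by rewrite lerBlDl dist_set_in_neighborhood.
by rewrite half_series_scale mulrC ler_wpM2r.
Unshelve. all: by end_near. Qed.

Lemma thinness_subset_ge i A B : A !=set0 -> A `<=` B ->
  (dist_set (u i) A - dist_set (u i) B) * 2^-1 ^+ i <= thinness A - thinness B.
Proof.
move=> A0 AB; have B0 : B !=set0 by case: A0 => a /AB; exists a.
have ge0 k : 0 <= (dist_set (u k) A - dist_set (u k) B) * 2^-1 ^+ k.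
  by rewrite mulr_ge0 ?exprn_ge0 ?invr_ge0// subr_ge0 dist_set_subset.
rewrite -(cvg_lim _ (thinnessB A0 B0))//.
apply: limr_ge; first by apply: cvgP; exact: thinnessB.
near=> n; have ltin : (i < n)%N by near: n; exact: nbhs_infty_gt.
rewrite /series /= (bigD1_seq i) ?iota_uniq ?mem_index_iota//=.
by rewrite lerDl sumr_ge0.
Unshelve. all: by end_near. Qed.

Lemma thinness_subset A B : A !=set0 -> A `<=` B -> thinness B <= thinness A.
Proof.
move=> A0 AB; rewrite -subr_ge0; apply: le_trans (thinness_subset_ge 0 A0 AB).
by rewrite mulr_ge0 ?exprn_ge0 ?invr_ge0// subr_ge0 dist_set_subset.
Qed.

Hypothesis u_dense : forall e, 0 < e ->
  exists N, forall p, exists2 i, (i < N)%N & mdist (u i) p < e.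

(** A uniform form of strict monotonicity. If some [b] in [B] is at distance at least [e] from [A],
    a term [u i] with [i < N] lies within [e / 4] of [b]; its distances to [A] and [B] differ by at
    least [e / 2], and its weight is at least [2^-1 ^+ N]. *)
Lemma thinness_modulus e : 0 < e -> exists2 d, 0 < d &
  forall A B, A !=set0 -> A `<=` B -> thinness A - thinness B < d ->
    in_neighborhood e B A.
Proof.
move=> e0; have e40 : 0 < e / 4 by rewrite divr_gt0.
have [N uN] := u_dense e40; exists (e / 2 * 2^-1 ^+ N).
  by rewrite mulr_gt0 ?divr_gt0// exprn_gt0// invr_gt0.
move=> A B A0 AB ABd b Bb; apply: contrapT => nb.
have far a : A a -> e <= mdist b a.
  by move=> Aa; rewrite leNgt; apply/negP => ba; apply: nb; exists a.
have [i iN ib] := uN b; move: ABd; apply/negP; rewrite -leNgt.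
apply: le_trans (thinness_subset_ge i A0 AB).
apply: ler_pM; rewrite ?divr_ge0 ?exprn_ge0 ?invr_ge0//; first exact: ltW.
  have iB : dist_set (u i) B <= e / 4 by apply: le_trans (dist_set_le _ Bb) (ltW ib).
  have iA : e - e / 4 <= dist_set (u i) A.
    apply: dist_set_ge => // a /far ba.
    by have := metric_triangle b (u i) a; rewrite (metric_sym b (u i)); lra.
  by lra.
by apply: ler_wiXn2l; rewrite ?invr_ge0 ?invf_le1 ?ler1n// ltnW.
Qed.

End thinness.

(** * Paths in the hyperspace *)

Section paths.
Context {R : realType} {X : continuumType R}.
Implicit Types (A B K : hyperspace X) (g : R -> hyperspace X) (x y : X) (e s t : R).

Lemma is_pathP g : is_path g <-> forall t, 0 <= t <= 1 -> forall e, 0 < e ->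
  exists2 d, 0 < d & forall s, 0 <= s <= 1 -> `|t - s| < d ->
    mdist (g t) (g s) < e.
Proof.
rewrite /is_path; split.
  move=> /subspace_continuousP gc t t01 e e0.
  have := gc t; rewrite /= in_itv/= => /(_ t01).
  move=> /(_ _ (nbhsx_ballx (g t) e e0)) /nbhs_ballP[d /= d0 dP].
  exists d => // s s01 ts; have := dP s ts.
  by rewrite /= in_itv/= => /(_ s01); rewrite ballEmdist.
move=> gc; apply/subspace_continuousP => t /=; rewrite in_itv/= => t01.
move=> U /nbhs_ballP[e /= e0 eU]; have [d d0 dP] := gc t t01 e e0.
apply/nbhs_ballP; exists d => //= s ts; rewrite /= in_itv/= => s01.
by apply: eU; rewrite ballEmdist; exact: dP.
Qed.

Lemma mem_closed_mdist (A : set X) x : closed A ->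
  (forall e, 0 < e -> exists2 a, A a & mdist x a < e) -> A x.
Proof.
move=> cA Ax; apply: cA => U /nbhs_ballP[e /= e0 eU].
by have [a Aa xa] := Ax e e0; exists a; split=> //; apply: eU; rewrite ballEmdist.
Qed.

Lemma notin_closed_mdist (A : set X) x : closed A -> ~ A x ->
  exists2 e, 0 < e & forall a, A a -> e <= mdist x a.
Proof.
move=> cA nAx; apply: contrapT => H; apply: nAx; apply: mem_closed_mdist => // e e0.
apply: contrapT => H1; apply: H; exists e => // a Aa.
by rewrite leNgt; apply/negP => xa; apply: H1; exists a.
Qed.

Lemma closed_compact (A : set X) : closed A -> compact A.
Proof. by move=> cA; apply: (subclosed_compact cA (@continuum_compact R X)). Qed.

Lemma open_ball_mdist (U : set X) x : open U -> U x ->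
  exists2 e, 0 < e & forall y, mdist x y < e -> U y.
Proof.
move=> oU Ux; have /nbhs_ballP[e /= e0 eU] : nbhs x U by exact: open_nbhs_nbhs.
by exists e => // y xy; apply: eU; rewrite ballEmdist.
Qed.

Lemma hausdorff_radii_mdist A B e : mdist A B < e -> hausdorff_radii A B e.
Proof. exact: hausdorff_dist_lt. Qed.

Lemma mdist_hausdorff_radii A B e : hausdorff_radii A B e -> mdist A B <= e.
Proof. exact: hausdorff_dist_le. Qed.

Lemma compact_subset_open A (O : set X) : open O -> A `<=` O ->
  exists2 e, 0 < e & forall a x, hset A a -> mdist a x < e -> O x.
Proof.
move=> oO AO; suff : \forall e \near (0:R)^'+, A `<=`
    (fun e a => forall x, mdist a x < e -> O x) e.
  case=> e /= e0 eP; exists (e / 2); first by rewrite divr_gt0.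
  move=> a x Aa; apply: eP Aa _; rewrite ?divr_gt0//=.
  by rewrite sub0r normrN gtr0_norm ?divr_gt0// ltr_pdivrMr// ltr_pMr// ltr1n.
apply: (compact_near_coveringP _).1.
  by apply: closed_compact; exact: hset_closed.
move=> a /AO Oa; have [e e0 eO] := open_ball_mdist oO Oa.
exists (ball a (e / 2), [set d | d < e / 2]) => /=.
  split; first by apply: nbhsx_ballx; rewrite divr_gt0.
  by apply: nbhs_right_lt; rewrite divr_gt0.
move=> [b d] /= [ab de] x bx; apply: eO; rewrite (splitr e).
move: ab; rewrite ballEmdist /= => ab.
by apply: le_lt_trans (metric_triangle _ b _) _; rewrite ltrD// (lt_trans bx).
Qed.

(** Let a relatively clopen part of [g t] contain [y]. The times [s] in [[0, t]] at which [g s] lies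
    inside this part form a clopen set containing 0, hence all of [[0, t]], so the part is [g t]
    itself. *)
Lemma connected_monotone_path g y : is_path g ->
  (forall s t, 0 <= s -> s <= t -> t <= 1 -> g s `<=` g t) ->
  g 0 = hset1 y -> forall t, 0 <= t <= 1 -> connected (g t).
Proof.
move=> /is_pathP gc gm g0 t /andP[t0 t1].
have gty : hset (g t) y by apply: (gm 0) => //; rewrite g0.
have clopen_full (U V : set X) : open U -> closed V ->
    g t `&` U = g t `&` V -> U y -> g t `<=` U.
  move=> oU cV UV Uy.
  pose J := [set s | s \in `[0, t] /\ g s `<=` U].
  have J01 s : s \in `[0, t] -> 0 <= s <= 1.
    by rewrite in_itv/= => /andP[-> st]; exact: le_trans t1.
  have gst s : s \in `[0, t] -> g s `<=` g t.
    by rewrite in_itv/= => /andP[? ?]; exact: gm.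
  have JU s : J s -> exists2 d, 0 < d & forall r, r \in `[0, t] -> `|s - r| < d -> J r.
    move=> [st sU]; have [e e0 eU] := compact_subset_open oU sU.
    have [d d0 dP] := gc s (J01 s st) e e0; exists d => // r rt sr; split=> // x rx.
    have /hausdorff_radii_mdist[_ _ /(_ x rx)[a ga xa]] := dP r (J01 r rt) sr.
    by apply: eU ga _; rewrite metric_sym.
  have JV s : s \in `[0, t] -> ~ J s ->
      exists2 d, 0 < d & forall r, r \in `[0, t] -> `|s - r| < d -> ~ J r.
    move=> st nJ; have [x gx nUx] : exists2 x, hset (g s) x & ~ U x.
      by apply: contrapT => H; apply: nJ; split=> // x gx; apply: contrapT => nUx;
         apply: H; exists x.
    have nVx : ~ V x.
      move=> Vx; apply: nUx; have : (g t `&` V) x by split=> //; exact: gst gx.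
      by rewrite -UV => -[].
    have [e e0 eV] := notin_closed_mdist cV nVx.
    have [d d0 dP] := gc s (J01 s st) e e0; exists d => // r rt sr [_ rU].
    have /hausdorff_radii_mdist[_ /(_ x gx)[a ga xa] _] := dP r (J01 r rt) sr.
    have : (g t `&` U) a by split; [exact: gst ga|exact: rU].
    by rewrite UV => -[_ /eV]; rewrite leNgt xa.
  suff JE : J = `[0, t]%classic.
    by have [] : J t; [rewrite JE /= in_itv/= t0 lexx|].
  apply: (@segment_connected R 0 t J).
  - exists 0; split; first by rewrite in_itv/= lexx.
    by rewrite g0 => _ ->.
  (* Adjoining everything outside [[0, t]] turns relative openness of [J] into openness in the
     line. *)
  - exists (J `|` ~` `[0, t]%classic)°; first exact: open_interior.
    apply/seteqP; split=> s.
      move=> Js; split; first by case: Js.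
      have [d d0 dP] := JU s Js; apply/nbhs_ballP; exists d => // r sr /=.
      by have [rt|/negP rt] := boolP (r \in `[0, t]); [left; exact: dP|right].
    by move=> [st /interior_subset[|/(_ st)]].
  - exists (closure J); first exact: closed_closure.
    apply/seteqP; split=> s.
      by move=> Js; split; [case: Js|exact: subset_closure].
    move=> [st clJ]; apply: contrapT => nJ; have [d d0 dP] := JV s st nJ.
    have [r [Jr sr]] := clJ _ (nbhsx_ballx s d d0).
    by apply: (dP r) => //; case: Jr.
move=> B [b Bb] [U oU BU] [V cV BV].
have UV : g t `&` U = g t `&` V by rewrite -BU.
have [Uy|nUy] := pselect (U y).
  by rewrite BU; apply: setIidl; exact: clopen_full UV Uy.
(* When [y] is outside [U], the argument applies to the complementary clopen part, so the part cut
   out by [U] is empty. *)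
have gV : g t `<=` ~` V.
  apply: (clopen_full _ (~` U)).
  - exact: closed_openC.
  - exact: open_closedC.
  - apply/seteqP; split=> x [gx nx]; split=> // h; apply: nx.
      by have : (g t `&` U) x by []; rewrite UV => -[].
    by have : (g t `&` V) x by []; rewrite -UV => -[].
  - by move=> Vy; have : (g t `&` V) y by []; rewrite -UV => -[].
by move: Bb; rewrite BV => -[/gV].
Qed.

End paths.

(** * Chains without gaps and their parametrization *)

Section chains.
Context {R : realType} {X : continuumType R}.
Variable u : nat -> X.
Hypothesis u_dense : forall e : R, 0 < e ->
  exists N, forall p, exists2 i, (i < N)%N & mdist (u i) p < e.
Implicit Types (A B D E : hyperspace X) (C : set (hyperspace X)).
Implicit Types (g : R -> hyperspace X) (x y : X) (e s t v : R).

(** Absence of gaps is expressed by the values of [thinness], so a chain can be built before any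
    parametrization is chosen. *)
Definition full_chain A B C :=
  [/\ forall D, C D -> A `<=` D /\ D `<=` B,
      forall D E, C D -> C E -> D `<=` E \/ E `<=` D &
      forall v, thinness u B <= v <= thinness u A ->
        exists2 D, C D & thinness u D = v].

Lemma full_chainU A B D C1 C2 : A `<=` B -> B `<=` D ->
  full_chain A B C1 -> full_chain B D C2 -> full_chain A D (C1 `|` C2).
Proof.
move=> AB BD [AC1B tot1 full1] [BC2D tot2 full2]; split.
- move=> E [/AC1B[AE EB]|/BC2D[BE ED]].
    by split=> //; exact: subset_trans EB BD.
  by split=> //; exact: subset_trans AB BE.
- have sub12 E F : C1 E -> C2 F -> E `<=` F.
    by move=> /AC1B[_ EB] /BC2D[BF _]; exact: subset_trans EB BF.
  move=> E F [CE|CE] [CF|CF].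
  + exact: tot1.
  + by left; exact: sub12.
  + by right; exact: sub12.
  + exact: tot2.
- move=> v /andP[Dv vA]; have [Bv|vB] := leP (thinness u B) v.
    by have [|E ? ?] := full1 v; [rewrite Bv|exists E => //; left].
  by have [|E ? ?] := full2 v; [rewrite Dv ltW|exists E => //; right].
Qed.

Lemma thinness_inj A B : A `<=` B -> thinness u A = thinness u B -> A = B.
Proof.
move=> AB thAB; apply/hyperspace_eq/seteqP; split=> // x Bx.
apply: mem_closed_mdist; first exact: hset_closed.
move=> e e0; have [d d0 dP] := thinness_modulus u_dense e0.
by apply: (dP A B) => //; [exact: hset_nonempty|rewrite thAB subrr].
Qed.

(** The member at time [t] is chosen with [thinness] affine in [t]. Within a chain smaller
    [thinness] means larger set, which gives strict growth; [thinness_modulus] gives continuity. *)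
Lemma order_arc_full_chain A B C : A `<=` B -> A <> B -> full_chain A B C ->
  exists g, [/\ order_arc g, g 0 = A, g 1 = B & forall t, 0 <= t <= 1 -> C (g t)].
Proof.
move=> AB neqAB [CAB tot full].
have th_sub D E : D `<=` E -> thinness u E <= thinness u D.
  by apply: thinness_subset; exact: hset_nonempty.
pose M := thinness u A - thinness u B.
have M0 : 0 < M.
  rewrite subr_gt0 lt_neqAle th_sub// andbT; apply/eqP => thAB.
  by apply: neqAB; exact: thinness_inj.
have pick t : exists D, 0 <= t <= 1 -> C D /\ thinness u D = thinness u A - t * M.
  have [t01|] := boolP (0 <= t <= 1); last by exists A.
  have [|D CD thD] := full (thinness u A - t * M); last by exists D.
  case/andP: t01 => t0 t1; apply/andP; split.
    by rewrite lerBrDr -lerBrDl ler_piMl// ltW.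
  by rewrite gerBl mulr_ge0// ltW.
have [g gP] := choice pick.
have thg t : 0 <= t <= 1 -> thinness u (g t) = thinness u A - t * M.
  by move=> /gP[].
have Cg t : 0 <= t <= 1 -> C (g t) by move=> /gP[].
have g_sub s t : 0 <= s -> s < t -> t <= 1 -> g s `<=` g t.
  move=> s0 st t1.
  have s01 : 0 <= s <= 1 by rewrite s0 (le_trans (ltW st)).
  have t01 : 0 <= t <= 1 by rewrite t1 (le_trans s0 (ltW st)).
  have [//|/th_sub] := tot _ _ (Cg s s01) (Cg t t01).
  by rewrite !thg// lerD2l lerN2 ler_pM2r// leNgt st.
exists g; split => //; last 2 first.
- apply/esym/thinness_inj; last by rewrite thg ?lexx//; lra.
  by have [] := CAB (g 0) (Cg 0 ltac:(by rewrite lexx ler01)).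
- apply/thinness_inj; last by rewrite thg ?lexx ?ler01// /M; lra.
  by have [] := CAB (g 1) (Cg 1 ltac:(by rewrite lexx ler01)).
split; last first.
  move=> s t s0 st t1; split; first exact: g_sub.
  move=> /th_sub; rewrite !thg ?s0 ?t1 ?(le_trans s0 (ltW st)) ?(le_trans (ltW st))//.
  by rewrite lerD2l lerN2 ler_pM2r// leNgt st.
apply/is_pathP => t t01 e e0; have e20 : 0 < e / 2 by rewrite divr_gt0.
have [d d0 dP] := thinness_modulus u_dense e20.
(* Along [g] the value of [thinness] falls at constant speed [M]. Members are nested, so only one
   half of the Hausdorff estimate needs the modulus. *)
exists (d / M); first by rewrite divr_gt0.
move=> s s01; rewrite ltr_pdivlMr// => tsd.
apply: (@le_lt_trans _ _ (e / 2)); last by rewrite ltr_pdivrMr// ltr_pMr// ltr1n.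
apply: mdist_hausdorff_radii.
have self D : in_neighborhood (e / 2) D D by move=> a Da; exists a; rewrite ?mdistxx.
have near D E : D `<=` E -> in_neighborhood (e / 2) D E.
  by move=> DE a /DE Ea; exists a; rewrite ?mdistxx.
have [st|ts|<-] := ltgtP s t; last by [].
- move: (s01) (t01) tsd => /andP[s0 s1] /andP[t0 t1].
  rewrite ger0_norm ?subr_ge0 1?ltW// => tsd.
  have gst := g_sub s t s0 st t1.
  split=> //; last exact: near.
  by apply: dP => //; [exact: hset_nonempty|rewrite !thg//; lra].
- move: (s01) (t01) tsd => /andP[s0 s1] /andP[t0 t1].
  rewrite ltr0_norm ?subr_lt0// => tsd.
  have gts := g_sub t s t0 ts s1.
  split=> //; first exact: near.
  by apply: dP => //; [exact: hset_nonempty|rewrite !thg//; lra].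
Qed.

End chains.

(* For an ultrafilter, the compactness of the hyperspace makes every family of
   sets converge; the limit is the set of the limits of selections. *)
Section ultralimit.
Context {R : realType} {X : continuumType R} {I : Type} (G : set_system I).
Context {GU : UltraFilter G}.
Implicit Types (S T : I -> set X) (K : set X) (p x : X) (e : R).

Let G_proper : ProperFilter G := @ultra_proper _ _ GU.

Definition ultralimit S : set X :=
  [set p | forall e, 0 < e -> \forall i \near G, exists2 q, S i q & mdist p q < e].

Lemma ultralimit_subset S T : (\forall i \near G, S i `<=` T i) ->
  ultralimit S `<=` ultralimit T.
Proof.
move=> ST p Sp e e0; have := Sp e e0; apply: filterS2 ST => i ST [q Sq pq].
by exists q => //; exact: ST.
Qed.

Lemma mem_ultralimit S p : (\forall i \near G, S i p) -> ultralimit S p.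
Proof. by move=> Sp e e0; apply: filterS Sp => i Sp; exists p; rewrite ?mdistxx. Qed.

Lemma ultralimit_sub_closed S K : closed K -> (\forall i \near G, S i `<=` K) ->
  ultralimit S `<=` K.
Proof.
move=> cK SK p Sp; apply: mem_closed_mdist => // e e0.
have [i [SiK [q Sq pq]]] := filter_ex (filterI SK (Sp e e0)).
by exists q => //; exact: SiK.
Qed.

Lemma closed_ultralimit S : closed (ultralimit S).
Proof.
move=> p clp e e0; have e20 : 0 < e / 2 by rewrite divr_gt0.
have [q [Sq]] := clp _ (nbhsx_ballx p _ e20); rewrite ballEmdist /= => pq.
apply: filterS (Sq _ e20) => i [x Sx qx]; exists x => //.
by apply: le_lt_trans (metric_triangle _ q _) _; rewrite (splitr e) ltrD.
Qed.

(** The limit is compact, so nearness at each of its points becomes uniform. *)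
Lemma ultralimit_in_neighborhood S e : 0 < e ->
  \forall i \near G, in_neighborhood e (ultralimit S) (S i).
Proof.
move=> e0; have e20 : 0 < e / 2 by rewrite divr_gt0.
apply: (compact_near_coveringP (ultralimit S)).1.
  by apply: closed_compact; exact: closed_ultralimit.
move=> p Sp; exists (ball p (e / 2), [set i | exists2 q, S i q & mdist p q < e / 2]).
  by split; [exact: nbhsx_ballx|exact: Sp].
move=> [x i] /= [+ [q Sq pq]]; rewrite ballEmdist /= metric_sym => xp.
by exists q => //; apply: le_lt_trans (metric_triangle _ p _) _; rewrite (splitr e) ltrD.
Qed.

(** The points at distance at least [e] from the limit form a compact set. Each of them is outside
    the limit, so by the ultrafilter dichotomy a ball around it misses [S i] for almost all [i];
    finitely many such balls suffice. *)
Lemma in_neighborhood_ultralimit S e : 0 < e ->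
  \forall i \near G, in_neighborhood e (S i) (ultralimit S).
Proof.
move=> e0; pose far := [set p : X | forall q, ultralimit S q -> e <= mdist p q].
have cfar : closed far.
  move=> p clp q Sq; rewrite leNgt; apply/negP => pq.
  have e10 : 0 < e - mdist p q by rewrite subr_gt0.
  have [x [/(_ q Sq) fx]] := clp _ (nbhsx_ballx p _ e10); rewrite ballEmdist /= => px.
  by have := metric_triangle x p q; rewrite (metric_sym x p); lra.
have : \forall i \near G, far `<=` [set p | ~ S i p].
  apply: (compact_near_coveringP far).1; first exact: closed_compact.
  move=> p fp; have [d d0 dS] : exists2 d, 0 < d &
      \forall i \near G, ~ exists2 q, S i q & mdist p q < d.
    apply: contrapT => H; suff Sp : ultralimit S p.
      by have := fp p Sp; rewrite mdistxx leNgt e0.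
    move=> d d0; have [//|nS] := in_ultra_setVsetC
      [set i | exists2 q, S i q & mdist p q < d] GU.
    by exfalso; apply: H; exists d.
  exists (ball p d, [set i | ~ exists2 q, S i q & mdist p q < d]).
    by split; [exact: nbhsx_ballx|].
  by move=> [x i] /= [+ nS] Sx; rewrite ballEmdist /= => px; apply: nS; exists x.
apply: filterS => i farS p Sp; apply: contrapT => H.
apply: (farS p) Sp => q Sq; rewrite leNgt; apply/negP => pq.
by apply: H; exists q.
Qed.

End ultralimit.

(** * Walks with small steps, and chains from a point to a subcontinuum *)

Section epsilon_chains.
Context {R : realType} {X : continuumType R}.
Implicit Types (K : hyperspace X) (x y p q : X) (e v : R) (n : nat).

Fixpoint walk (e : R) (K : set X) (y : X) (n : nat) : set X :=
  if n is m.+1 then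
    K `&` [set p | exists2 q, walk e K y m q & mdist p q < e]
  else [set y].

Lemma walk_subset e K y n : hset K y -> walk e K y n `<=` K.
Proof. by case: n => [|n] Ky p /=; [move=> ->|case]. Qed.

Lemma walkS e K y n : 0 < e -> hset K y -> walk e K y n `<=` walk e K y n.+1.
Proof.
move=> e0 Ky p wp; split; first exact: walk_subset wp.
by exists p; rewrite ?mdistxx.
Qed.

Lemma walk_le e K y m n : 0 < e -> hset K y -> (m <= n)%N ->
  walk e K y m `<=` walk e K y n.
Proof.
move=> e0 Ky; elim: n => [|n IHn]; first by rewrite leqn0 => /eqP ->.
rewrite leq_eqVlt => /predU1P[-> //|/IHn]; move/subset_trans; apply.
exact: walkS.
Qed.

Lemma walk_start e K y n : 0 < e -> hset K y -> walk e K y n y.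
Proof. by move=> e0 Ky; apply: (@walk_le e K y 0). Qed.

(** Points of [K] within [e] of the union of all walks belong to it, so the union is clopen in [K]
    and equals [K]; compactness then yields a single [n]. *)
Lemma walk_full e K y : 0 < e -> connected K -> hset K y ->
  exists n, walk e K y n = K.
Proof.
move=> e0 cK Ky; pose S := \bigcup_n walk e K y n.
have stepS p q : hset K p -> S q -> mdist p q < e -> S p.
  by move=> Kp [n _ wq] pq; exists n.+1 => //; split=> //; exists q.
have SK : S `<=` K by move=> p [n _]; exact: walk_subset.
have KS : S = K.
  apply: cK; first by exists y, 0%N.
  - exists (S `|` ~` hset K)°; first exact: open_interior.
    apply/seteqP; split=> p; last by move=> [Kp /interior_subset[|/(_ Kp)]].
    move=> Sp; split; first exact: SK.
    apply/nbhs_ballP; exists e => // q; rewrite ballEmdist /= metric_sym => qp.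
    by have [Kq|] := pselect (hset K q); [left; exact: stepS Sp qp|right].
  - exists (closure S); first exact: closed_closure.
    apply/seteqP; split=> p.
      by move=> Sp; split; [exact: SK|exact: subset_closure].
    move=> [Kp clp]; have [q [Sq]] := clp _ (nbhsx_ballx p e e0).
    by rewrite ballEmdist /= => pq; exact: stepS Sq pq.
suff [n wn] : exists n, K `<=` walk e K y n.
  by exists n; apply/seteqP; split=> //; exact: walk_subset.
suff : \forall n \near \oo, hset K `<=` (fun n p => hset K p -> walk e K y n p) n.
  by case=> n _ /(_ n (leqnn n)) Kw; exists n => p Kp; exact: Kw.
apply: (compact_near_coveringP _).1.
  by apply: closed_compact; exact: hset_closed.
move=> p Kp; have [n _ wp] : S p by rewrite KS.
exists (ball p e, [set m | (n < m)%N]).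
  by split; [exact: nbhsx_ballx|exact: nbhs_infty_gt].
move=> [q m] /= [+ nm] Kq; rewrite ballEmdist /= metric_sym => qp.
by apply: (walk_le e0 Ky nm); split=> //; exists p.
Qed.

Variable u : nat -> X.

Lemma exists_small_step_chain e K y : 0 < e -> connected K -> hset K y ->
  exists W : R -> set X,
    [/\ forall v, W v y, forall v, W v `<=` K,
        forall v v', v <= v' -> W v' `<=` W v &
        forall v, thinness u K <= v <= thinness u [set y] ->
          v - 2 * e <= thinness u (W v) <= v].
Proof.
move=> e0 cK Ky.
(* Walks grow with [n], so this is the first one of [thinness] at most [v], or [K] if there is none.
   The previous walk exceeds [v], and one step lowers [thinness] by at most [2 * e]. *)
exists (fun v => hset K `&` \bigcap_(n in [set n | thinness u (walk e K y n) <= v])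
  walk e K y n); split.
- by move=> v; split=> // n _; exact: walk_start.
- by move=> v p [].
- move=> v v' vv' p [Kp wp]; split=> // n /= nv; apply: wp => /=.
  exact: le_trans vv'.
move=> v /andP[Kv vy]; have [N wN] := walk_full e0 cK Ky.
have ex_v : exists n, thinness u (walk e K y n) <= v by exists N; rewrite wN.
have [n nv nmin] := ex_minnP ex_v.
have -> : hset K `&` \bigcap_(n in [set n | thinness u (walk e K y n) <= v])
  walk e K y n = walk e K y n.
  apply/seteqP; split=> [p [_ /(_ n nv)] //|p wp].
  by split=> [|m /= /nmin nm]; [exact: walk_subset wp|exact: walk_le nm _ wp].
rewrite nv andbT; case: n nv nmin => [|n] nv nmin.
  by apply: le_trans vy; rewrite gerBl mulr_ge0// ltW.
have vn : v < thinness u (walk e K y n).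
  by rewrite ltNge; apply/negP => /nmin; rewrite ltnn.
have stepn : in_neighborhood e (walk e K y n.+1) (walk e K y n) by move=> p [_].
have w0 m : walk e K y m !=set0 by exists y; exact: walk_start.
by have := thinness_in_neighborhood u (ltW e0) (w0 n) (w0 n.+1) stepn; lra.
Qed.

(** The error [2 * e] of the small-step chains vanishes in the limit, so the limit at level [v] has
    [thinness] exactly [v]; inclusions survive the limit. *)
Lemma full_chain_point K y : connected K -> hset K y ->
  exists C, full_chain u (hset1 y) K C.
Proof.
move=> cK Ky.
have pick e : exists W : R -> set X, 0 < e ->
    [/\ forall v, W v y, forall v, W v `<=` K,
        forall v v', v <= v' -> W v' `<=` W v &
        forall v, thinness u K <= v <= thinness u [set y] ->
          v - 2 * e <= thinness u (W v) <= v].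
  have [e0|] := boolP (0 < e); last by exists (fun=> set0).
  by have [W WP] := exists_small_step_chain e0 cK Ky; exists W.
have [W WP] := choice pick.
have [G [GU G0]] := ultraFilterLemma (at_right_proper_filter (0 : R)).
have G_proper : ProperFilter G := ultra_proper.
have Gpos : \forall e \near G, 0 < e by apply: G0; exact: nbhs_right_gt.
pose L v := ultralimit G (fun e => W e v).
have Ly v : L v y.
  by apply: mem_ultralimit; apply: filterS Gpos => e /WP[].
have LK v : L v `<=` K.
  apply: ultralimit_sub_closed; first exact: hset_closed.
  by apply: filterS Gpos => e /WP[].
have Lmono v v' : v <= v' -> L v' `<=` L v.
  move=> vv'; apply: ultralimit_subset; apply: filterS Gpos => e /WP[_ _ + _].
  exact.
(* Passing between [W e v] and its limit costs [2 * r] either way; the lower bound loses another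
   [2 * e], less than [2 * r]. *)
have thL v : thinness u K <= v <= thinness u [set y] -> thinness u (L v) = v.
  move=> vP; suff near_v r : 0 < r -> v - 4 * r <= thinness u (L v) <= v + 2 * r.
    apply/eqP; rewrite eq_le; apply/andP; split; apply/ler_addgt0Pr => r r0.
      have r20 : 0 < r / 2 by rewrite divr_gt0.
      by have /andP[_] := near_v _ r20; lra.
    have r40 : 0 < r / 4 by rewrite divr_gt0.
    by have /andP[+ _] := near_v _ r40; lra.
  move=> r0; have Gr : \forall e \near G, e < r by apply: G0; exact: nbhs_right_lt.
  have [e [[[e0 er] LW] WL]] := filter_ex (filterI (filterI (filterI Gpos Gr)
    (ultralimit_in_neighborhood (fun e => W e v) r0))
    (in_neighborhood_ultralimit (fun e => W e v) r0)).
  have [Wy _ _ /(_ v vP)/andP[vW Wv]] := WP e e0.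
  have L0 : L v !=set0 by exists y.
  have W0 : W e v !=set0 by exists y.
  have := thinness_in_neighborhood u (ltW r0) W0 L0 LW.
  have := thinness_in_neighborhood u (ltW r0) L0 W0 WL.
  by rewrite -/(L v) => ? ?; lra.
exists [set D | exists v, hset D = L v]; split.
- by move=> D [v ->]; split=> // p ->.
- move=> D E [v ->] [w ->]; have [vw|wv] := leP v w.
    by right; exact: Lmono.
  by left; apply: Lmono; exact: ltW.
- move=> v vP; have Lc : closed (L v) by exact: closed_ultralimit.
  exists (Hyperspace Lc (ex_intro _ y (Ly v))); first by exists v.
  exact: thL.
Qed.

End epsilon_chains.

(** * Unblocked points and the set of points blocked by [a] *)

Section unblocked_points.
Context {R : realType} {X : continuumType R}.
Implicit Types (A B D K : hyperspace X) (C : set (hyperspace X)).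
Implicit Types (g : R -> hyperspace X) (a x y z p q : X) (e s t v : R).

(** A path witnessing that a point is not blocked need not grow. Collecting its past makes it grow,
    and still avoids [a] before time 1 if [K] does. *)
Let swept g K t : set X :=
  hset K `|` [set x | exists2 s, 0 <= s <= t & hset (g s) x].

Let swept_le g K s t : s <= t -> swept g K s `<=` swept g K t.
Proof.
move=> st x [|[r /andP[r0 rs] gx]]; [by left|right].
by exists r; rewrite // r0 (le_trans rs).
Qed.

(** By compactness of the time interval, a point outside every [g s] has one neighborhood disjoint
    from all of them. *)
Let swept_closed g K t : is_path g -> t <= 1 -> closed (swept g K t).
Proof.
move=> /is_pathP gc t1 p clp; apply: contrapT => nUp.
have Kp : ~ hset K p by move=> Kp; apply: nUp; left.
have gp s : 0 <= s <= t -> ~ hset (g s) p by move=> st gp; apply: nUp; right; exists s.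
have [e e0 eK] := notin_closed_mdist (@hset_closed _ _ K) Kp.
have : \forall q \near p, `[0, t]%classic `<=`
    (fun q s => s \in `[0, t] -> ~ hset (g s) q) q.
  apply: (compact_near_coveringP _).1; first exact: segment_compact.
  move=> s; rewrite /= in_itv/= => /andP[s0 st].
  have [r r0 rg] := notin_closed_mdist (@hset_closed _ _ (g s)) (gp s ltac:(by rewrite s0)).
  have r20 : 0 < r / 2 by rewrite divr_gt0.
  have [d d0 dP] := gc s ltac:(by rewrite s0 (le_trans st)) _ r20.
  exists (ball s d, ball p (r / 2)); first by split; exact: nbhsx_ballx.
  move=> [s' q] /= [ss' +]; rewrite ballEmdist /= in_itv/= => pq /andP[s'0 s't] gq.
  have /hausdorff_radii_mdist[_ _ /(_ q gq)[b gb qb]] :=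
    dP s' ltac:(by rewrite s'0 (le_trans s't)) ss'.
  by have := rg b gb; have := metric_triangle p q b; lra.
move=> near_p.
have [q [[Kq|[s st gq]]]] := clp _ (filterI (nbhsx_ballx p e e0) near_p).
  by rewrite ballEmdist /= => -[]; rewrite ltNge eK.
by move=> [_ /(_ s)]; apply; rewrite //= in_itv.
Qed.

Let swept_continuous (u : nat -> X) g K : is_path g ->
  {within `[0, 1], continuous (fun t => thinness u (swept g K t))}.
Proof.
move=> /is_pathP gc; apply/subspace_continuousP => t /=; rewrite in_itv/= => t01.
move=> V /nbhs_ballP[e /= e0 eV].
(* Two values of [g] near [g t] are then within [e / 4] of each other, so [thinness] varies by at
   most [e / 2]. *)
have e40 : 0 < e / 4 / 2 by rewrite !divr_gt0.
have [d d0 dP] := gc t t01 _ e40.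
have U0 r : swept g K r !=set0 by have [k Kk] := hset_nonempty K; exists k; left.
have step s r : 0 <= s -> s <= r -> r <= 1 -> `|t - s| < d -> `|t - r| < d ->
    `|thinness u (swept g K s) - thinness u (swept g K r)| < e.
  move=> s0 sr r1 tsd trd.
  rewrite ger0_norm; last by rewrite subr_ge0 thinness_subset//; exact: swept_le.
  apply: (@le_lt_trans _ _ (2 * (e / 4))); last by lra.
  apply: thinness_in_neighborhood => //; first by lra.
  move=> p [Kp|[w /andP[w0 wr] gp]]; first by exists p; [left|rewrite mdistxx; lra].
  have [ws|sw] := leP w s.
    by exists p; [right; exists w; rewrite ?w0|rewrite mdistxx; lra].
  have s01 : 0 <= s <= 1 by rewrite s0 (le_trans sr).
  have w01 : 0 <= w <= 1 by rewrite w0 (le_trans wr).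
  have twd : `|t - w| < d by move: tsd trd; rewrite !ltr_norml; lra.
  have gws : mdist (g w) (g s) < e / 4.
    apply: le_lt_trans (metric_triangle _ (g t) _) _.
    by rewrite (splitr (e / 4)) ltrD//; [rewrite metric_sym|]; exact: dP.
  have /hausdorff_radii_mdist[_ /(_ p gp)[b gb pb] _] := gws.
  by exists b => //; right; exists s; rewrite // s0 lexx.
have tt : `|t - t| < d by rewrite subrr normr0.
move: (t01) => /andP[t0 t1].
apply/nbhs_ballP; exists d => //= s ts; rewrite in_itv/= => /andP[s0 s1].
apply: eV; rewrite /ball /=; have [st|ts'] := leP s t.
  by rewrite distrC; exact: step.
by apply: step => //; exact: ltW.
Qed.

(** The swept sets grow from [K], which contains [z], to the whole space; the intermediate value
    theorem for their [thinness] excludes gaps. *)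
Lemma full_chain_path (u : nat -> X) g K z a : is_path g -> g 0 = hset1 z ->
  hset (g 1) = setT -> (forall t, 0 <= t < 1 -> ~ hset (g t) a) ->
  hset K z -> ~ hset K a ->
  exists C, full_chain u K (g 1) C /\
    forall D, C D -> hset D = setT \/ ~ hset D a.
Proof.
move=> gc g0 g1 ga Kz Ka.
exists [set D | exists2 t, 0 <= t <= 1 & hset D = swept g K t]; split; last first.
  move=> D [t /andP[t0 t1] ->]; have [tlt|tge] := ltP t 1.
    right=> -[//|[s /andP[s0 st]]]; apply: ga.
    by rewrite s0 (le_lt_trans st).
  left; apply/seteqP; split=> // p _; right; exists 1; first by rewrite ler01.
  by rewrite g1.
split.
- move=> D [t _ ->]; split; first by left.
  by rewrite g1.
- move=> D E [s _ ->] [t _ ->]; have [st|ts] := leP s t.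
    by left; exact: swept_le.
  by right; apply: swept_le; exact: ltW.
move=> v vP.
have U0 : swept g K 0 = K.
  apply/seteqP; split=> [p|p]; last by left.
  by move=> [//|[s]]; rewrite -eq_le => /eqP <-; rewrite g0 => ->.
have U1 : swept g K 1 = g 1.
  rewrite g1; apply/seteqP; split=> // p _; right; exists 1.
    by rewrite ler01 lexx.
  by rewrite g1.
have [|t] := @IVT _ _ 0 1 v ler01 (@swept_continuous u g K gc).
  by rewrite U0 U1 ge_min le_max; case/andP: vP => -> ->; rewrite orbT.
rewrite in_itv/= => t01 thv.
have Uc : closed (swept g K t) by apply: swept_closed => //; case/andP: t01.
have Une : swept g K t !=set0 by exists z; left.
by exists (Hyperspace Uc Une) => //; exists t.
Qed.

(** A chain from [y] up to [K] is continued by the sets swept out from [K] along the path of [z];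
    the union is parametrized as an order arc. *)
Lemma order_arc_avoiding a K y z : subcontinua K -> ~ hset K a ->
  hset K y -> hset K z -> ~ blocked_by a z ->
  exists g, [/\ order_arc g, forall t, 0 <= t <= 1 -> subcontinua (g t),
    g 0 = hset1 y, hset (g 1) = setT &
    forall t, 0 <= t < 1 -> ~ hset (g t) a].
Proof.
move=> cK Ka Ky Kz /contrapT[h [hc h0 h1 ha]].
have {}ha t : 0 <= t < 1 -> ~ hset (h t) a.
  by move=> t01 hta; have : (hset (h t) `&` hset (hset1 a)) a by []; rewrite ha.
have [u u_dense] := @exists_uniformly_dense_sequence R X.
have [C1 chain1] := full_chain_point u cK Ky.
have [C2 [chain2 C2a]] := full_chain_path u hc h0 h1 ha Kz Ka.
have yK : hset1 y `<=` K by move=> p ->.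
have Kh : K `<=` h 1 by rewrite h1.
have [||g [go g0 g1 gC]] := order_arc_full_chain u_dense _ _ (full_chainU yK Kh chain1 chain2).
- exact: subset_trans Kh.
- move=> yh; have : hset (hset1 y) a by rewrite yh h1.
  by move=> /= ay; apply: Ka; rewrite ay.
have [gc gs] := go.
exists g; split=> //.
- move=> t t01; apply: (connected_monotone_path gc _ g0 t01) => s r s0 sr r1.
  move: sr; rewrite le_eqVlt => /predU1P[-> //|sr].
  by have [] := gs s r s0 sr r1.
- by rewrite g1.
move=> t /andP[t0 t1]; have [|CD|CD] := gC t.
- by rewrite t0 ltW.
- have [sub12 _ _] := chain1; have [_ gK] := sub12 _ CD.
  by move=> /gK.
- have [gT|//] := C2a _ CD.
  (* Strict growth forbids reaching the whole space before time 1. *)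
  by have [_ []] := gs t 1 t0 t1 (lexx 1); rewrite gT.
Qed.

Lemma blocked_by_self a : blocked_by a a.
Proof.
move=> [g [_ g0 _ /(_ 0)]]; rewrite lexx ltr01 g0 => /(_ isT) ga.
by have : (hset (hset1 a) `&` hset (hset1 a)) a by []; rewrite ga.
Qed.

Lemma unblocked_subcontinuum a K y z : subcontinua K -> ~ hset K a ->
  hset K y -> hset K z -> ~ blocked_by a z -> ~ blocked_by a y.
Proof.
move=> cK Ka Ky Kz Bz; have [g [[gc _] _ g0 g1 ga]] := order_arc_avoiding cK Ka Ky Kz Bz.
apply; exists g; split=> // t t01; apply/seteqP; split=> // p [gp /= pa].
by apply: (ga t t01); rewrite -pa.
Qed.

Lemma order_arc_unblocked a y : ~ blocked_by a y ->
  exists g, [/\ order_arc g, forall t, 0 <= t <= 1 -> subcontinua (g t),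
    g 0 = hset1 y, hset (g 1) = setT &
    forall t, 0 <= t < 1 -> ~ hset (g t) a].
Proof.
move=> By; apply: (@order_arc_avoiding a (hset1 y) y y) => //.
  exact: connected1.
by move=> /= ay; apply: By; rewrite -ay; exact: blocked_by_self.
Qed.

Lemma closed_blocked_by a : kelley X -> closure (blocked_by a) <> [set: X] ->
  closed (blocked_by a).
Proof.
move=> kX nd p clp; apply: contrapT => Bp.
have [w nw] : exists w, ~ closure (blocked_by a) w.
  apply: contrapT => H; apply: nd; apply/seteqP; split=> // w _.
  by apply: contrapT => nw; apply: H; exists w.
have oU : open (~` closure (blocked_by a)).
  by apply: closed_openC; exact: closed_closure.
have UB q : (~` closure (blocked_by a)) q -> ~ blocked_by a q.
  by move=> nq Bq; apply: nq; exact: subset_closure.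
have [e e0 eU] := open_ball_mdist oU nw.
have [g [[/is_pathP gc gs] gcon g0 g1 ga]] := order_arc_unblocked Bp.
have [d d0 dP] := gc 1 ltac:(by rewrite ler01 lexx) e e0.
(* A time before 1, so that [g t] misses [a], but late enough that [g t] comes within [e] of [w]. *)
have [t t01 td] : exists2 t, 0 < t < 1 & `|1 - t| < d.
  have [d1|d1] := ltP d 1.
    exists (1 - d / 2); first by lra.
    by rewrite ger0_norm; lra.
  by exists (2^-1); [lra|rewrite ger0_norm; lra].
have /andP[t0 t1] := t01.
have gtp : hset (g t) p by have [+ _] := gs 0 t (lexx 0) t0 (ltW t1); apply; rewrite g0.
have gta : ~ hset (g t) a by apply: ga; rewrite ltW.
have gtc : subcontinua (g t) by apply: gcon; rewrite !ltW.
have /hausdorff_radii_mdist[_ /(_ w)] := dP t ltac:(by rewrite !ltW) td.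
rewrite g1 => /(_ I)[k gk wk] _.
have [e1 e10 e1U] := open_ball_mdist oU (eU k wk).
have [||e2 e20 e2a] := @compact_subset_open _ _ (g t) (~` [set a]).
- by apply: closed_openC; exact: hset1_closed.
- by move=> q gq /= qa; apply: gta; rewrite -qa.
(* The bound [e1] makes the nearby continuum [L] meet the open set of unblocked points, and [e2]
   keeps it away from [a]. *)
have [|r r0 rP] := kX (Num.min e1 e2); first by rewrite lt_min e10.
have [q [Bq]] := clp _ (nbhsx_ballx p r r0); rewrite ballEmdist /= => pq.
have [L [cL Lq]] := rP p q (g t) pq gtc gtp.
move=> /hausdorff_radii_mdist[_ gL Lg]; have [l Ll kl] := gL k gk.
apply: (unblocked_subcontinuum cL _ Lq Ll _ Bq).
  by move=> /Lg[b gb ab]; apply: (e2a b a gb); rewrite // metric_sym (lt_le_trans ab)// ge_min lexx orbT.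
by apply: UB; apply: e1U; rewrite (lt_le_trans kl)// ge_min lexx.
Qed.

(** If the arc from an unblocked [x] met [B] at [p] before time 1, that stage would be a
    subcontinuum missing [a] and joining [p] to [x], so [p] would be unblocked. *)
Lemma nonblocker_blocked_by a (B : hyperspace X) :
  hset B = blocked_by a -> hset B <> setT -> nonblocker B.
Proof.
move=> BE nB; split=> // x; rewrite BE => nBx.
have [g [go gcon g0 g1 ga]] := order_arc_unblocked nBx; exists g; split=> //.
have [gc gs] := go.
move=> t /andP[t0 t1]; apply/seteqP; split=> // p [gp]; apply.
have gx : hset (g t) x.
  move: t0; rewrite le_eqVlt => /predU1P[<-|t0]; first by rewrite g0.
  by have [+ _] := gs 0 t (lexx 0) t0 (ltW t1); apply; rewrite g0.
have gtc : subcontinua (g t) by apply: gcon; rewrite t0 ltW.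
have gta : ~ hset (g t) a by apply: ga; rewrite t0.
by have := unblocked_subcontinuum gtc gta gp gx nBx; rewrite /blocked_by /= => /contrapT.
Qed.

(** An arc that avoids [A] until time 1 also avoids its point [a], so its starting point is
    unblocked. *)
Lemma blocked_by_subset_nonblocker a A : nonblocker A -> hset A a ->
  blocked_by a `<=` A.
Proof.
move=> [_ nA] Aa p Bp; apply: contrapT => Ap; apply: Bp.
have [g [[gc _] _ g0 g1 gA]] := nA p Ap; exists g; split=> // t t01.
apply/seteqP; split=> // q [gq /= qa].
by have : (hset (g t) `&` hset A) q; [split=> //; rewrite qa|rewrite gA].
Qed.

End unblocked_points.

Theorem theorem3p12 (R : realType) (X : continuumType R) (hX : kelley X)
  (x : X) (hx : closure (blocked_by x) <> [set: X]) :
  nonblocker_hull x = blocked_by x.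
Proof.
apply/seteqP; split=> y; last first.
  by move=> By A [nA Ax]; exact: blocked_by_subset_nonblocker By.
(* Being closed and proper, the blocked set is itself one of the nonblockers being intersected. *)
have cB := closed_blocked_by hX hx.
pose B := Hyperspace cB (ex_intro _ x (@blocked_by_self _ _ x)).
move=> hy; apply: (hy B); split; last exact: blocked_by_self.
apply: (@nonblocker_blocked_by _ _ x B erefl) => BT; apply: hx.
by rewrite -(closure_id _).1.
Qed.
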